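(* Let $n$ be a positive integer, $A\in\mathbb{R}^{n\times n}$, and $H=\begin{bmatrix}H_1&\cdots&H_n\end{bmatrix}\in\mathbb{R}^{n\times n^2}$ with $H_i\in\mathbb{R}^{n\times n}$, where $H(x_1\otimes x_2)=H(x_2\otimes x_1)$ for all $x_1,x_2\in\mathbb{R}^n$. Consider the quadratic system $$\dot{x}=Ax+H(x\otimes x),\qquad x(t)\in\mathbb{R}^n.$$ Let $\varepsilon>0$ be given. If $P=P^\top\in\mathbb{R}^{n\times n}$ with $P\succ0$ satisfies the linear matrix inequality $$\begin{bmatrix}AP+PA^\top+\varepsilon\sum_{i=1}^n H_iPH_i^\top & P\\ P & -\varepsilon I_n\end{bmatrix}\prec0,$$ then $$\widehat{\mathcal{E}}=\{x\in\mathbb{R}^n : x^\top P^{-1}x\le1\}$$ is an ellipsoidal (inner) approximation of the region of attraction $\mathcal{R}$ of the origin for the quadratic system, i.e. $\widehat{\mathcal{E}}\subseteq\mathcal{R}$, and the quadratic form $V(x)=x^\top P^{-1}x$ is a Lyapunov function for the system inside $\widehat{\mathcal{E}}$.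
   Context: $\otimes$ is the standard Kronecker product, so $H(x\otimes x)=\sum_{i=1}^n H_i x\,e_i^\top x$, where $e_i$ is the $i$-th standard basis vector of $\mathbb{R}^n$. $\succ0$ and $\prec0$ denote positive and negative definiteness of symmetric matrices; $I_n$ is the $n\times n$ identity. Let $\phi(t,x(0))$ denote the solution of the quadratic system at time $t$ from initial condition $x(0)$. The region of attraction of the equilibrium at the origin is $\mathcal{R}=\{x(0)\in\mathbb{R}^n:\lim_{t\to\infty}\phi(t,x(0))=0\}$. ''$V$ is a Lyapunov function for the system inside $\widehat{\mathcal{E}}$'' means: $V(0)=0$ and $V(x)>0$ for all $x\in\widehat{\mathcal{E}}\setminus\{0\}$; and, with $\dot V(x)=\nabla V(x)^\top\left(Ax+H(x\otimes x)\right)$ the derivative along trajectories, $\dot V(0)=0$ and $\dot V(x)<0$ for all $x\in\widehat{\mathcal{E}}\setminus\{0\}$. *)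

(* Defs.v *)
From HB Require Import structures.
From mathcomp Require Import all_boot all_order all_algebra.
From mathcomp Require Import all_classical all_reals all_analysis.

Set Implicit Arguments.
Unset Strict Implicit.
Unset Printing Implicit Defensive.

Import Order.TTheory GRing.Theory Num.Theory.
Import numFieldNormedType.Exports.

Local Open Scope classical_set_scope.
Local Open Scope ring_scope.

Definition qform (R : realType) (n : nat) (M : 'M[R]_n) (x : 'cV[R]_n) : R :=
  (x^T *m M *m x) 0 0.

Definition posdef (R : realType) (n : nat) (M : 'M[R]_n) : Prop :=
  M^T = M /\ forall x : 'cV[R]_n, x != 0 -> 0 < qform M x.

Definition negdef (R : realType) (n : nat) (M : 'M[R]_n) : Prop :=
  M^T = M /\ forall x : 'cV[R]_n, x != 0 -> qform M x < 0.

(* The Kronecker product of two column vectors, as the stack of the blocks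
   x_i y; its height \sum_(i < m) n is m * n, written in the form that matches
   the width of a row \mxrow_(i < m) of blocks with n columns each. *)
Definition kron (R : realType) (m n : nat) (x : 'cV[R]_m) (y : 'cV[R]_n) :
    'cV[R]_(\sum_(i < m) n) :=
  \mxcol_(i < m) (x i 0 *: y).

Definition quad_field (R : realType) (n : nat) (A : 'M[R]_n)
    (H : 'I_n -> 'M[R]_n) (x : 'cV[R]_n) : 'cV[R]_n :=
  A *m x + (\mxrow_(i < n) H i) *m kron x x.

(* A solution of x' = f(x), x(0) = x0, on the whole half-line [0, +oo[.
   Only the values of phi at nonnegative times matter; as f is continuous in
   all uses, the equation extends to the right derivative at t = 0. *)
Definition is_solution (R : realType) (n : nat) (f : 'cV[R]_n -> 'cV[R]_n)
    (x0 : 'cV[R]_n) (phi : R -> 'cV[R]_n) : Prop :=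
  [/\ phi 0 = x0,
      {within `[0, +oo[, continuous phi} &
      forall t : R, 0 < t -> is_derive t 1 phi (f (phi t))].

(* The solution from x0 exists for all t >= 0 and tends to 0. Since "the"
   solution is not chosen by a function here, convergence is required of every
   solution from x0 (there is just one on [0, +oo[ for locally Lipschitz f). *)
Definition region_of_attraction (R : realType) (n : nat)
    (f : 'cV[R]_n -> 'cV[R]_n) : set 'cV[R]_n :=
  [set x0 | (exists phi : R -> 'cV[R]_n, is_solution f x0 phi) /\
            forall phi : R -> 'cV[R]_n, is_solution f x0 phi ->
              phi t @[t --> +oo] --> (0 : 'cV[R]_n)].

Definition gradient (R : realType) (n : nat) (V : 'cV[R]_n -> R)
    (x : 'cV[R]_n) : 'cV[R]_n :=
  \col_i 'D_(delta_mx i 0) V x.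

Definition orbital_derivative (R : realType) (n : nat)
    (f : 'cV[R]_n -> 'cV[R]_n) (V : 'cV[R]_n -> R) (x : 'cV[R]_n) : R :=
  ((gradient V x)^T *m f x) 0 0.

(* Differentiability is part of the notion: without it the total operator 'D
   in the gradient would carry no information. *)
Definition is_lyapunov (R : realType) (n : nat) (f : 'cV[R]_n -> 'cV[R]_n)
    (E : set 'cV[R]_n) (V : 'cV[R]_n -> R) : Prop :=
  [/\ forall x, E x -> differentiable V x,
      V 0 = 0,
      forall x, E x -> x != 0 -> 0 < V x,
      orbital_derivative f V 0 = 0 &
      forall x, E x -> x != 0 -> orbital_derivative f V x < 0].

(* Main.v *)
Require Import Defs.
From HB Require Import structures.
From mathcomp Require Import all_boot all_order all_algebra.
From mathcomp Require Import all_classical all_reals all_analysis.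
From mathcomp Require Import ring lra.

(** Test the matrix inequality on the vector (P^-1 x, x/eps) and bound each
    cross term 2 x_i x^T P^-1 H_i x by
      eps w_i^T P w_i + x_i^2 V(x) / eps,  where w_i = H_i^T P^-1 x.
    This gives V'(x) <= ((V(x) - 1) / eps - c) |x|^2 with c > 0, so V decays
    exponentially as long as V <= 1 + d, for some d > 0. Hence a trajectory
    started in the ellipsoid cannot leave it, and it converges to 0. For the
    existence of a global solution, the state is clipped to a box containing
    {V <= 1 + d}: the clipped field is bounded and globally Lipschitz, so Picard
    iteration converges on the whole half-line, and by invariance its solution
    also solves the original equation. *)

Set Implicit Arguments.
Unset Strict Implicit.
Unset Printing Implicit Defensive.

Import Order.TTheory GRing.Theory Num.Theory.
Import numFieldNormedType.Exports.

Local Open Scope classical_set_scope.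
Local Open Scope ring_scope.

(** * Quadratic forms and definite matrices *)

Section quadratic_forms.
Context {R : realType} {n : nat}.
Implicit Types (M : 'M[R]_n) (x y : 'cV[R]_n).

Lemma qformE M x : qform M x = \sum_j \sum_i x i 0 * M i j * x j 0.
Proof.
rewrite /qform !mxE; apply: eq_bigr => j _; rewrite mxE mulr_suml.
by apply: eq_bigr => i _; rewrite mxE.
Qed.

Lemma qform1E x : qform 1%:M x = \sum_i x i 0 ^+ 2.
Proof.
rewrite /qform mulmx1 !mxE; apply: eq_bigr => i _.
by rewrite mxE expr2.
Qed.

Lemma qform0 M : qform M 0 = 0.
Proof. by rewrite /qform mulmx0 mxE. Qed.

Lemma qform1_ge0 x : 0 <= qform 1%:M x.
Proof. by rewrite qform1E sumr_ge0// => i _; exact: sqr_ge0. Qed.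

Lemma tr_mx11 (N : 'M[R]_1) : N^T 0 0 = N 0 0.
Proof. by rewrite mxE. Qed.

Lemma bilinear_sym M x y : M^T = M -> (x^T *m M *m y) 0 0 = (y^T *m M *m x) 0 0.
Proof.
by move=> MT; rewrite -[LHS]tr_mx11 !trmx_mul trmxK MT mulmxA.
Qed.

Lemma qformBZ M x y (s : R) : M^T = M ->
  qform M (x - s *: y) =
  qform M x - s * (2 * (y^T *m M *m x) 0 0) + s ^+ 2 * qform M y.
Proof.
move=> MT; rewrite /qform [(_ - _)^T]linearB/= [(_ *: _)^T]linearZ/=.
rewrite !mulmxBl !mulmxBr -!scalemxAl -!scalemxAr.
have e (U V : 'M[R]_1) : (U - V) 0 0 = U 0 0 - V 0 0 by rewrite !mxE.
have f a (U : 'M[R]_1) : (a *: U) 0 0 = a * U 0 0 by rewrite mxE.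
rewrite !(e, f) (bilinear_sym x y MT); ring.
Qed.

Lemma posdef_ge0 M x : posdef M -> 0 <= qform M x.
Proof.
move=> [_ M0]; have [->|/M0/ltW//] := eqVneq x 0; by rewrite qform0.
Qed.

(** A singular matrix has a nonzero left null vector, and the form would vanish there. *)
Lemma posdef_unit M : posdef M -> M \in unitmx.
Proof.
move=> [MT M0]; rewrite unitmxE unitfE; apply/negP => /det0P[v v0 vM].
have /M0 : v^T != 0 by apply: contra v0 => /eqP v0; rewrite -(trmxK v) v0 trmx0.
by rewrite /qform trmxK vM mul0mx mxE ltxx.
Qed.

(** The form of [invmx M] at [x] is the form of [M] at [invmx M *m x]. *)
Lemma posdef_invmx M : posdef M -> posdef (invmx M).
Proof.
move=> Mpos; have Mu := posdef_unit Mpos; case: Mpos => [MT M0].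
have QT : (invmx M)^T = invmx M by rewrite trmx_inv MT.
split=> // x x0; have /M0 : invmx M *m x != 0.
  by apply: contra x0 => /eqP e; rewrite -(mulKVmx Mu x) e mulmx0.
by rewrite /qform trmx_mul QT -!mulmxA mulKVmx.
Qed.

(* Testing positivity on [x - s M^-1 e_i] gives
   [x_i^2 <= (M^-1)_ii * qform M x]. *)
Lemma posdef_coercive M : posdef M ->
  exists2 c : R, 0 < c & forall x, c * qform 1%:M x <= qform M x.
Proof.
move=> Mpos; have Mu := posdef_unit Mpos; have MT := Mpos.1.
pose d : R := 1 + \sum_i `|invmx M i i|.
have d0 : 0 < d by rewrite ltr_wpDr// sumr_ge0.
have dle i : invmx M i i <= d.
  rewrite (le_trans (ler_norm _))// /d (bigD1 i)//= addrCA lerDl addr_ge0//.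
  by rewrite sumr_ge0.
have key x i : x i 0 ^+ 2 <= d * qform M x.
  pose y : 'cV_n := invmx M *m delta_mx i 0.
  have My : M *m y = delta_mx i 0 by rewrite mulKVmx.
  have yMx : (y^T *m M *m x) 0 0 = x i 0.
    by rewrite -(bilinear_sym _ _ MT) -mulmxA My -colE !mxE.
  have yMy : qform M y = invmx M i i.
    by rewrite /qform -mulmxA My -colE mxE mxE /y -colE mxE.
  (* The optimal [s] is [x i 0] divided by the diagonal entry of [invmx M]; the uniform bound [d]
     replaces that entry, which avoids dividing by it. *)
  have := posdef_ge0 (x - (x i 0 / d) *: y) Mpos.
  rewrite qformBZ// yMx yMy => h.
  have : x i 0 ^+ 2 / d ^+ 2 * invmx M i i <= x i 0 ^+ 2 / d.
    rewrite (_ : _ / d = x i 0 ^+ 2 / d ^+ 2 * d); last by field; rewrite gt_eqF.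
    by rewrite ler_wpM2l// divr_ge0// sqr_ge0.
  rewrite expr_div_n in h => h'.
  rewrite mulrC -ler_pdivrMr//.
  have : x i 0 / d * (2 * x i 0) = 2 * (x i 0 ^+ 2 / d) by field; rewrite gt_eqF.
  by move: h h'; set a := _ / d * (2 * _); set b := _ * invmx M i i; lra.
(* Summing the [n] coordinate bounds gives the factor [n * d]; [n.+1] keeps it invertible when
   [n = 0]. *)
exists (n.+1%:R * d)^-1; first by rewrite invr_gt0 mulr_gt0.
move=> x; rewrite ler_pdivrMl ?mulr_gt0// qform1E.
apply: (@le_trans _ _ (\sum_(i < n) d * qform M x)); first exact: ler_sum.
rewrite sumr_const card_ord -[leLHS]mulr_natl -[leRHS]mulrA ler_wpM2r ?ler_nat//.
by rewrite mulr_ge0 ?posdef_ge0// ltW.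
Qed.

Lemma qform_le M :
  exists2 k : R, 0 < k & forall x, qform M x <= k * qform 1%:M x.
Proof.
exists (1 + \sum_j \sum_i `|M i j|).
  by rewrite ltr_wpDr// sumr_ge0// => j _; exact: sumr_ge0.
move=> x; rewrite mulrDl mul1r.
rewrite (@le_trans _ _ ((\sum_j \sum_i `|M i j|) * qform 1%:M x))//;
  last by rewrite lerDr qform1_ge0.
rewrite qformE mulr_suml; apply: ler_sum => j _.
rewrite mulr_suml; apply: ler_sum => i _.
rewrite mulrAC mulrC (le_trans (ler_norm _))// normrM ler_wpM2l//.
have sq k : x k 0 ^+ 2 <= qform 1%:M x.
  rewrite qform1E (bigD1 k)//= lerDl sumr_ge0// => l _; exact: sqr_ge0.
have := sq i; have := sq j; rewrite normrM -(real_normK (num_real (x i 0))).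
rewrite -(real_normK (num_real (x j 0))).
(* The product of two entries is at most the mean of their squares, each of which is at most the
   Euclidean square. *)
have : 0 <= (`|x i 0| - `|x j 0|) ^+ 2 by exact: sqr_ge0.
nra.
Qed.

End quadratic_forms.

(** * From the matrix inequality to a decay estimate for the quadratic field *)

Lemma quad_fieldE (R : realType) (n : nat) (A : 'M[R]_n) (H : 'I_n -> 'M[R]_n)
    (x : 'cV[R]_n) :
  quad_field A H x = A *m x + \sum_i x i 0 *: (H i *m x).
Proof.
rewrite /quad_field /kron mul_mxrow_mxcol; congr (_ + _).
by apply: eq_bigr => i _; rewrite scalemxAr.
Qed.

Section lmi.
Context {R : realType} {n : nat}.
Variables (A : 'M[R]_n) (H : 'I_n -> 'M[R]_n) (eps : R) (P : 'M[R]_n).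
Hypotheses (eps0 : 0 < eps) (Ppos : posdef P).

Local Notation Q := (invmx P).

Local Notation S := (A *m P + P *m A^T + eps *: \sum_(i < n) (H i *m P *m (H i)^T)).

(* The LMI is tested on the vector [(P^-1 x, x / eps)]. *)
Lemma lmi_qform (x : 'cV[R]_n) :
  qform (block_mx S P P (- (eps *: 1%:M))) (col_mx (Q *m x) (eps^-1 *: x)) =
  2 * (x^T *m Q *m A *m x) 0 0
  + eps * (\sum_i qform P ((H i)^T *m Q *m x)) + eps^-1 * qform 1%:M x.
Proof.
have Pu := posdef_unit Ppos; have [QT _] := posdef_invmx Ppos.
rewrite /qform tr_col_mx mul_row_block mul_row_col.
rewrite !mulmxDl [(_ *: _)^T]linearZ/= !trmx_mul QT.
have -> : x^T *m Q *m S *m (Q *m x) = x^T *m Q *m A *m x + (x^T *m Q *m A *m x)^T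
    + eps *: \sum_i ((H i)^T *m Q *m x)^T *m P *m ((H i)^T *m Q *m x).
  rewrite /S !mulmxDr !mulmxDl; congr (_ + _ + _).
  - by rewrite -!mulmxA mulKVmx.
  - by rewrite !trmx_mul trmxK QT -!mulmxA mulKmx.
  - rewrite -scalemxAr -scalemxAl; congr (_ *: _).
    rewrite mulmx_sumr mulmx_suml; apply: eq_bigr => i _.
    by rewrite !trmx_mul trmxK QT !mulmxA.
(* Each off-diagonal block contributes [|x|^2 / eps] and the lower right block [- |x|^2 / eps], so a
   single copy remains. *)
have -> : eps^-1 *: x^T *m P *m (Q *m x) = eps^-1 *: (x^T *m x).
  by rewrite -!mulmxA mulKVmx// scalemxAl.
have -> : x^T *m Q *m P *m (eps^-1 *: x) = eps^-1 *: (x^T *m x).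
  by rewrite mulmxKV// scalemxAr.
have -> : eps^-1 *: x^T *m - (eps *: 1%:M) *m (eps^-1 *: x) =
    - (eps^-1 *: (x^T *m x)).
  rewrite mulmxN mulNmx -!scalemxAr mulmx1.
  by rewrite [eps *: _]scalerA mulfV ?gt_eqF// scale1r.
rewrite subrr addr0 mulmx1.
have D (U V : 'M[R]_1) : (U + V) 0 0 = U 0 0 + V 0 0 by rewrite mxE.
have Z a (U : 'M[R]_1) : (a *: U) 0 0 = a * U 0 0 by rewrite mxE.
by rewrite !(D, Z) tr_mx11 summxE -mulr2n mulr_natl.
Qed.

Hypothesis lmi : negdef (block_mx S P P (- (eps *: 1%:M))).

Lemma lmi_dissipation : exists2 c : R, 0 < c & forall x : 'cV[R]_n,
  2 * (x^T *m Q *m quad_field A H x) 0 0 <=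
  (eps^-1 * (qform Q x - 1) - c) * qform 1%:M x.
Proof.
have Pu := posdef_unit Ppos; have Qpos := posdef_invmx Ppos.
have [QT _] := Qpos; have [PT _] := Ppos.
have : posdef (- block_mx S P P (- (eps *: 1%:M))).
  split=> [|v v0]; first by rewrite linearN/= lmi.1.
  rewrite /qform mulmxN mulNmx mxE oppr_gt0; exact: lmi.2.
move=> /posdef_coercive[c c0 cS].
(* Only the lower half [x / eps] of the test vector is kept in the coercivity bound; its Euclidean
   square is [|x|^2 / eps^2]. *)
exists (c * eps^-1 ^+ 2); first by rewrite mulr_gt0// exprn_gt0// invr_gt0.
move=> x.
have lmix : 2 * (x^T *m Q *m A *m x) 0 0
    + eps * (\sum_i qform P ((H i)^T *m Q *m x)) + eps^-1 * qform 1%:M x <=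
    - (c * eps^-1 ^+ 2 * qform 1%:M x).
  rewrite -lmi_qform lerNr.
  have := cS (col_mx (Q *m x) (eps^-1 *: x)).
  rewrite [X in _ <= X -> _]/qform mulmxN mulNmx mxE; apply: le_trans.
  rewrite -mulrA ler_wpM2l ?(ltW c0)// !qform1E big_split_ord/=.
  rewrite mulr_sumr ler_wpDl ?sumr_ge0// => [i _|]; first exact: sqr_ge0.
  by apply: ler_sum => i _; rewrite col_mxEd mxE exprMn.
have young i : 2 * x i 0 * (x^T *m Q *m H i *m x) 0 0 <=
    eps * qform P ((H i)^T *m Q *m x) + eps^-1 * qform Q x * x i 0 ^+ 2.
  (* Young's inequality in the inner product of [P], between [(H i)^T *m Q *m x] and [Q *m x]; the
     second vector has [P]-form [qform Q x]. *)
  have := posdef_ge0 ((H i)^T *m Q *m x - (x i 0 / eps) *: (Q *m x)) Ppos.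
  rewrite qformBZ//.
  have -> : ((Q *m x)^T *m P *m ((H i)^T *m Q *m x)) 0 0 = (x^T *m Q *m H i *m x) 0 0.
    rewrite -[RHS]tr_mx11 !trmx_mul QT trmxK -!mulmxA; congr ((_ *m _) 0 0).
    by rewrite !mulmxA mulVmx// mul1mx.
  have -> : qform P (Q *m x) = qform Q x.
    by rewrite /qform trmx_mul QT -!mulmxA mulKVmx.
  move/(mulr_ge0 (ltW eps0)); set a := qform P _; set b := qform Q x.
  set w := (_ *m x) 0 0.
  have -> : eps * (a - x i 0 / eps * (2 * w) + (x i 0 / eps) ^+ 2 * b) =
    eps * a - 2 * x i 0 * w + eps^-1 * b * x i 0 ^+ 2 by field; rewrite gt_eqF.
  by lra.
have -> : 2 * (x^T *m Q *m quad_field A H x) 0 0 = 2 * (x^T *m Q *m A *m x) 0 0 +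
    \sum_i 2 * x i 0 * (x^T *m Q *m H i *m x) 0 0.
  rewrite quad_fieldE mulmxDr mxE mulrDr mulmxA; congr (_ + _).
  rewrite mulmx_sumr summxE mulr_sumr; apply: eq_bigr => i _.
  by rewrite -scalemxAr mxE mulmxA mulrA.
apply: (@le_trans _ _ (2 * (x^T *m Q *m A *m x) 0 0 +
    \sum_i (eps * qform P ((H i)^T *m Q *m x) + eps^-1 * qform Q x * x i 0 ^+ 2))).
  by rewrite lerD2l; apply: ler_sum.
rewrite big_split/= -!mulr_sumr -qform1E; move: lmix.
set a := 2 * _; set b := eps * _; set s := qform 1%:M x; set v := qform Q x.
by rewrite mulrBl mulrBr mulr1 [(_ - _) * s]mulrBl; lra.
Qed.

Lemma lyapunov_decay : exists2 d : R, 0 < d & exists2 c : R, 0 < c &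
  forall x : 'cV[R]_n, qform Q x <= 1 + d ->
    2 * (x^T *m Q *m quad_field A H x) 0 0 <= - c * qform Q x.
Proof.
have [c c0 cQ] := lmi_dissipation; have [k k0 Qk] := qform_le Q.
(* For [V <= 1 + d] this choice gives [(V - 1) / eps <= c / 2], so half of the dissipation survives;
   [V <= k |x|^2] turns it into a rate in terms of [V]. *)
exists (eps * c / 2); first by rewrite !mulr_gt0.
exists (c / 2 / k); first by rewrite !divr_gt0.
move=> x xd; apply: le_trans (cQ x) _.
apply: (@le_trans _ _ (- (c / 2) * qform 1%:M x)).
  rewrite ler_wpM2r ?qform1_ge0//.
  suff : eps^-1 * (qform Q x - 1) <= c / 2 by lra.
  by rewrite ler_pdivrMl// lerBlDl mulrA.
by rewrite !mulNr lerN2 -[leLHS]mulrA ler_pM2l ?divr_gt0// ler_pdivrMl.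
Qed.

End lmi.

(** * Norms and derivatives of vector functions, entry by entry *)

Section matrix_calculus.
Context {R : realType}.

Lemma mx_entry_le_norm {m n : nat} (M : 'M[R]_(m, n)) i j : `|M i j| <= `|M|.
Proof.
rewrite [leRHS]/Num.Def.normr/= mx_normrE.
exact: (le_bigmax _ (fun ij => `|M ij.1 ij.2|) (i, j)).
Qed.

Lemma mx_norm_leP {m n : nat} (M : 'M[R]_(m, n)) (a : R) : 0 <= a ->
  reflect (forall i j, `|M i j| <= a) (`|M| <= a).
Proof.
move=> a0; apply: (iffP idP) => [Ma i j|Ma].
  exact: le_trans (mx_entry_le_norm _ _ _) Ma.
by rewrite [leLHS]/Num.Def.normr/= mx_normrE; apply: bigmax_le => // -[i j] _ /=.
Qed.

Lemma is_derive_mxP {U : normedModType R} {m n : nat} (M : U -> 'M[R]_(m, n))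
    (t v : U) (D : 'M[R]_(m, n)) :
  is_derive t v M D <-> forall i j, is_derive t v (fun x => M x i j) (D i j).
Proof.
split=> [[dM DE] i j|dM].
  have /derivable_mxP/(_ i j) := dM => dMij; split=> //.
  by rewrite -DE derive_mx// mxE.
have dM' : derivable M t v by apply/derivable_mxP => i j; exact: ex_derive.
split=> //; rewrite derive_mx//; apply/matrixP => i j; rewrite mxE.
exact: derive_val.
Qed.

(** The domain is a general normed space so that one chain rule serves both for trajectories, with
    time as variable, and for the gradient, with [phi] the identity. *)
Lemma is_derive_qform {U : normedModType R} {n : nat} (Q : 'M[R]_n)
    (phi : U -> 'cV[R]_n) (t v : U) (w : 'cV[R]_n) : Q^T = Q ->
  is_derive t v phi w ->
  is_derive t v (fun s => qform Q (phi s)) (2 * ((phi t)^T *m Q *m w) 0 0).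
Proof.
move=> QT /is_derive_mxP dphi.
have -> : (fun s => qform Q (phi s)) =
    \sum_j \sum_i (fun s => phi s i 0 * Q i j * phi s j 0).
  apply/funext => s; rewrite qformE fct_sumE; apply: eq_bigr => j _.
  by rewrite fct_sumE.
have dij i j : is_derive t v (fun s => phi s i 0 * Q i j * phi s j 0)
    (phi t i 0 * Q i j * w j 0 + w i 0 * Q i j * phi t j 0).
  have di := dphi i 0; have dj := dphi j 0.
  apply: is_derive_eq; rewrite /GRing.scale/=. ring.
apply: is_derive_eq.
rewrite mulr_natl mulr2n -[in X in _ = _ + X](bilinear_sym w (phi t) QT).
rewrite !mxE -big_split/=; apply: eq_bigr => j _.
rewrite big_split/= !mxE !mulr_suml; congr (_ + _).
  by apply: eq_bigr => i _; rewrite mxE.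
by apply: eq_bigr => i _; rewrite mxE.
Qed.

Lemma differentiable_qform {n : nat} (Q : 'M[R]_n) (x : 'cV[R]_n) :
  differentiable (qform Q) x.
Proof.
have -> : qform Q = \sum_j \sum_i (fun s : 'cV[R]_n => s i 0 * Q i j * s j 0).
  apply/funext => s; rewrite qformE fct_sumE; apply: eq_bigr => j _.
  by rewrite fct_sumE.
apply: differentiable_sum => j; apply: differentiable_sum => i.
apply: differentiableM; last exact: differentiable_coord.
by apply: differentiableM => //; exact: differentiable_coord.
Qed.

Lemma orbital_derivative_qform {n : nat} (f : 'cV[R]_n -> 'cV[R]_n) (Q : 'M[R]_n)
    (x : 'cV[R]_n) : Q^T = Q ->
  orbital_derivative f (qform Q) x = 2 * (x^T *m Q *m f x) 0 0.
Proof.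
move=> QT; rewrite /orbital_derivative /gradient mxE [in RHS]mxE mulr_sumr.
apply: eq_bigr => i _; rewrite !mxE mulrA; congr (_ * _).
have -> : 'D_(delta_mx i 0) (qform Q) x = 2 * (x^T *m Q *m delta_mx i (0 : 'I_1)) 0 0.
  have ? := is_derive_qform QT (is_derive_id x (delta_mx i 0)).
  exact: derive_val.
by congr (_ * _); rewrite -colE !mxE.
Qed.

(** Both [h - U] and [h + U] have nonnegative derivative, hence are nondecreasing. The Picard
    estimates rest on this comparison instead of bounds on integrals. *)
Lemma derive_le_increment (U u h h' : R -> R) :
  (forall t : R, 0 <= t -> is_derive t 1 U (u t)) ->
  (forall t : R, 0 <= t -> is_derive t 1 h (h' t)) ->
  (forall t : R, 0 <= t -> `|u t| <= h' t) ->
  forall s t : R, 0 <= s -> s <= t -> `|U t - U s| <= h t - h s.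
Proof.
move=> dU dh uh s t s0 st.
have key (sg : R) : `|sg| = 1 -> sg * (U t - U s) <= h t - h s.
  move=> sg1; pose G := h - sg *: U.
  have dG (r : R) : 0 <= r -> is_derive r 1 G (h' r - sg * u r).
    by move=> r0; have := dU r r0; have := dh r r0 => ? ?; exact: is_deriveB.
  have : G s <= G t.
    apply: (@ger0_derive1_ndecry _ G 0) => //.
    - by move=> x /[!in_itv]/= /[!andbT]/ltW/dG.
    - move=> x /[!in_itv]/= /[!andbT] /ltW x0; rewrite derive1E.
      have ? := dG x x0; rewrite derive_val subr_ge0.
      by rewrite (le_trans (ler_norm _))// normrM sg1 mul1r uh.
    - apply: derivable_within_continuous => x /[!in_itv]/= /[!andbT]/dG.
      by move=> ?; exact: ex_derive.
  rewrite /G !fctE /GRing.scale/=; rewrite mulrBr; lra.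
rewrite ler_norml; apply/andP; split; last by rewrite -[leLHS]mul1r key// normr1.
by rewrite lerNl -mulN1r key// normrN1.
Qed.

Lemma derive_le_increment_mx {n : nat} (U u : R -> 'cV[R]_n) (h h' : R -> R) :
  (forall t : R, 0 <= t -> is_derive t 1 U (u t)) ->
  (forall t : R, 0 <= t -> is_derive t 1 h (h' t)) ->
  (forall t : R, 0 <= t -> `|u t| <= h' t) ->
  forall s t : R, 0 <= s -> s <= t -> `|U t - U s| <= h t - h s.
Proof.
move=> dU dh uh s t s0 st.
(* The entrywise criterion for the norm asks for a nonnegative bound; the scalar comparison with the
   zero function provides it. *)
have hst : 0 <= h t - h s.
  have : `|cst (0 : R) t - cst 0 s| <= h t - h s.
    apply: (@derive_le_increment (cst 0) (cst 0) h h') => // r r0.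
    by rewrite normr0 (le_trans _ (uh r r0)).
  exact: le_trans.
apply/mx_norm_leP => // i j; rewrite !mxE.
apply: (@derive_le_increment (fun r => U r i j) (fun r => u r i j) h h') => // r r0.
  by have /is_derive_mxP := dU r r0.
exact: le_trans (mx_entry_le_norm _ _ _) (uh r r0).
Qed.

End matrix_calculus.

(** * Scalar differential inequalities on the half-line *)

Section dissipation.
Context {R : realType}.
Implicit Types (W w : R -> R).

Lemma is_derive_expRM (c s : R) :
  is_derive s 1 (fun s : R => expR (c * s)) (expR (c * s) * c).
Proof.
have dc : is_derive s 1 (fun s : R => c * s) c.
  by have := @is_deriveZ _ _ _ id c s 1 1 _; rewrite /GRing.scale/= mulr1; apply.
exact: (is_derive1_comp (is_derive_expR _) dc).
Qed.

(* Otherwise apply the mean value theorem just after the last time at which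
   [W <= a]: there [a < W <= a + d], so [W] cannot increase. *)
Lemma decay_invariant W w (a d c : R) : 0 < d -> 0 <= c ->
  {within `[0, +oo[, continuous W} -> (forall t : R, 0 < t -> is_derive t 1 W (w t)) ->
  0 <= a -> W 0 <= a ->
  (forall t : R, 0 < t -> W t <= a + d -> w t <= - c * W t) ->
  forall t : R, 0 <= t -> W t <= a.
Proof.
move=> d0 c0 cW dW a0 W0 wW t1 t10; rewrite leNgt; apply/negP => W1.
pose S := [set s : R | 0 <= s <= t1 /\ W s <= a].
have S0 : S 0 by split=> //; rewrite lexx.
have Sub : ubound S t1 by move=> s [/andP[]].
have hS : has_sup S by split; [exists 0|exists t1].
pose s0 := sup S.
have hub := hS.2.
have s0ge : 0 <= s0 by exact: ub_le_sup.
have s0le : s0 <= t1 by exact: (ge_sup (ex_intro _ 0 S0) Sub).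
(* Continuity within the half-line in epsilon form, one-sided at [s = 0]. *)
have cWs (s : R) : 0 <= s -> forall e : R, 0 < e ->
    \forall r \near s, (0 <= r :> R) -> `|W s - W r| < e.
  move=> s0' e e0; have /cvgrPdist_lt/(_ e e0) := cW s.
  rewrite /nbhs/= /nbhs_subspace/= mem_set/=; last by rewrite in_itv/= s0'.
  rewrite /within/= /prop_near1/=; move=> H.
  have {}H : nbhs s (fun r : R => r \in `[0, +oo[%R -> `|W s - W r| < e) by [].
  apply: filterS H => r h r0; apply: h.
  by rewrite in_itv/= r0.
(* The supremum belongs to [S]: were [W s0 > a], continuity would give [W > a] at points of [S]
   close to [s0]. *)
have Ws0 : W s0 <= a.
  rewrite leNgt; apply/negP => Wa.
  have := cWs _ s0ge (W s0 - a); rewrite subr_gt0 => /(_ Wa)[e/= e0 he].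
  have [s [/andP[s1 s2] sa] se] := sup_adherent e0 hS.
  have ss0 : s <= s0 by apply: ub_le_sup => //; split=> //; rewrite s1.
  have := he s; rewrite /ball_/= ger0_norm ?subr_ge0// => /(_ _ s1).
  have -> : s0 - s < e by rewrite ltrBlDl -ltrBlDr.
  by move=> /(_ isT); rewrite ltr_norml => /andP[_]; lra.
have s0lt : s0 < t1.
  by rewrite lt_neqAle s0le andbT; apply: contraTneq W1 => <-; rewrite -leNgt.
have gta t : s0 < t <= t1 -> a < W t.
  move=> /andP[st tt]; rewrite ltNge; apply/negP => Wt.
  have : t <= s0.
    by apply: ub_le_sup => //; split=> //; rewrite tt (le_trans s0ge)// ltW.
  by rewrite leNgt st.
have [e/= e0 he] := cWs _ s0ge d d0.
pose t2 := Num.min t1 (s0 + e / 2).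
have st2 : s0 < t2 by rewrite lt_min s0lt ltrDl divr_gt0.
have t2t1 : t2 <= t1 by rewrite ge_min lexx.
have t2e : t2 <= s0 + e / 2 by rewrite ge_min lexx orbT.
have [||x xin xE] := @MVT _ W w s0 t2 st2.
- by move=> x /[!in_itv]/= /andP[sx _]; apply: dW; exact: le_lt_trans sx.
- apply: continuous_subspaceW cW => x /=; rewrite !in_itv/= => /andP[sx _].
  by rewrite andbT (le_trans s0ge).
move: xin; rewrite in_itv/= => /andP[sx xt].
have x0 : 0 < x by exact: le_lt_trans sx.
have Wx : a < W x by apply: gta; rewrite sx (le_trans (ltW xt)).
have : w x <= - c * W x.
  apply: wW => //; have := he x; rewrite /ball_/=.
  rewrite ltr0_norm ?subr_lt0// opprB => /(_ _ (ltW x0)).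
  have -> : x - s0 < e.
    rewrite ltrBlDl (lt_le_trans xt)// (le_trans t2e)// lerD2l.
    by rewrite ler_pdivrMr// ler_peMr ?ler1n// ltW.
  by move=> /(_ isT); rewrite ltr_norml => /andP[]; lra.
have : 0 < W t2 - W s0.
  by rewrite subr_gt0 (le_lt_trans Ws0)// gta// st2.
rewrite xE pmulr_lgt0 ?subr_gt0// => w0 w1.
have := lt_le_trans w0 w1; rewrite mulNr oppr_gt0 ltNge mulr_ge0//.
by rewrite (le_trans a0)// ltW.
Qed.

(** The product of [W] with the integrating factor [expR (c * s)] is nonincreasing. *)
Lemma decay_exp W w (c : R) :
  {within `[0, +oo[, continuous W} -> (forall t : R, 0 < t -> is_derive t 1 W (w t)) ->
  (forall t : R, 0 < t -> w t <= - c * W t) ->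
  forall t : R, 0 <= t -> W t <= W 0 * expR (- c * t).
Proof.
move=> cW dW wW t t0.
pose G (s : R) := W s * expR (c * s).
have dG (s : R) : 0 < s -> is_derive s 1 G (expR (c * s) * (w s + c * W s)).
  move=> s0; have ? := dW s s0.
  have ? := is_derive_expRM c s.
  apply: is_derive_eq; rewrite /GRing.scale/=; ring.
suff : G t <= G 0.
  by rewrite /G mulr0 expR0 mulr1 -ler_pdivlMr ?expR_gt0// -expRN mulNr.
apply: (@ler0_derive1_nincry _ G 0) => //.
- by move=> x /[!in_itv]/= /[!andbT]/dG.
- move=> x /[!in_itv]/= /[!andbT] x0; rewrite derive1E.
  have ? := dG x x0; rewrite derive_val pmulr_rle0 ?expR_gt0//.
  by have := wW x x0; lra.
- move=> x; apply: cvgM; first exact: cW.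
  apply: continuous_subspaceT => y; apply: continuous_comp; last exact: continuous_expR.
  exact: mulrl_continuous.
Qed.

End dissipation.

(** * Picard iteration for a bounded, globally Lipschitz field *)

Section picard.
Context {R : realType}.

(** Integrating from [-1] makes every [t >= 0], including [0], interior to the interval, so that the
    derivative is two-sided there. *)
Definition antiderivative (u : R -> R) (t : R) : R :=
  \int[lebesgue_measure]_(s in `[-1, t]) u s -
  \int[lebesgue_measure]_(s in `[-1, 0]) u s.

Lemma is_derive_antiderivative (u : R -> R) (t : R) : continuous u -> 0 <= t ->
  is_derive t 1 (antiderivative u) (u t).
Proof.
move=> cu t0.
have iu : lebesgue_measure.-integrable `[-1, t + 1] (EFin \o u).
  apply: continuous_compact_integrable; first exact: segment_compact.
  exact: continuous_subspaceT.
have tt1 : t < t + 1 by rewrite ltrDl.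
have [dF FE] := continuous_FTC1_closed tt1 iu (lt_le_trans (ltrN10 R) t0) (cu t).
have : is_derive t 1 (fun x : R => \int[lebesgue_measure]_(s in `[-1, x]) u s) (u t).
  by split=> //; rewrite -derive1E.
move=> dF'; have := is_deriveB dF' (is_derive_cst _ _ _).
by rewrite subr0; apply.
Qed.

Lemma lipschitz_real_continuous (v : R -> R) (K : R) :
  (forall s t, `|v s - v t| <= K * `|s - t|) -> continuous v.
Proof.
move=> vK s; apply/cvgrPdist_lt => e e0.
(* The sign of [K] is not known; [|K| + 1] is a positive Lipschitz constant. *)
have K0 : 0 < `|K| + 1 by rewrite ltr_wpDl.
exists (e / (`|K| + 1)) => /=; first by rewrite divr_gt0.
move=> t /= st; apply: le_lt_trans (vK _ _) _.
rewrite ltr_pdivlMr// mulrC in st; apply: le_lt_trans st.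
by rewrite ler_wpM2r// (le_trans (ler_norm _))// lerDl.
Qed.

(** By the Archimedean property and [k <= 2 ^+ k], the error drops below any positive gap [x - y].
    This passes estimates on the iterates to the limit. *)
Lemma le_geometric_eps (x y M : R) : (forall k, x <= y + M / 2 ^+ k) -> x <= y.
Proof.
move=> xy; rewrite leNgt; apply/negP => yx.
pose k := Num.bound (`|M| / (x - y)).
have xy0 : 0 < x - y by rewrite subr_gt0.
have : `|M| / (x - y) < k%:R by apply: archi_boundP; rewrite divr_ge0// ltW.
have k2 : k%:R <= 2 ^+ k :> R by rewrite -natrX ler_nat ltnW// ltn_expl.
have p0 : 0 < 2 ^+ k :> R by exact: exprn_gt0.
have := xy k; rewrite -lerBlDl ler_pdivlMr// => h1.
rewrite ltr_pdivrMr// => h2.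
have h3 : k%:R * (x - y) <= (x - y) * 2 ^+ k by rewrite mulrC ler_wpM2l// ltW.
have := ler_norm M; lra.
Qed.

(** Nested intervals: [u k - 2 * K / 2 ^+ k] increases, [u k + 2 * K / 2 ^+ k] decreases, and the
    supremum of the lower ends lies in all of them. *)
Lemma geometric_limit (u : nat -> R) (K : R) : 0 <= K ->
  (forall k, `|u k.+1 - u k| <= K / 2 ^+ k) ->
  exists l, forall k, `|u k - l| <= 2 * K / 2 ^+ k.
Proof.
move=> K0 uK.
have half k : 2 * K / 2 ^+ k.+1 = K / 2 ^+ k by rewrite exprS; field; rewrite gt_eqF.
have half' k : 2 * K / 2 ^+ k = K / 2 ^+ k + K / 2 ^+ k.
  by rewrite -mulrA mulr2n mulrDl !mul1r.
pose a k := u k - 2 * K / 2 ^+ k; pose b k := u k + 2 * K / 2 ^+ k.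
have ua : nondecreasing_seq a.
  apply/nondecreasing_seqP => k; rewrite /a half half'.
  by have := uK k; rewrite ler_norml => /andP[]; lra.
have ub : nonincreasing_seq b.
  apply/nonincreasing_seqP => k; rewrite /b half half'.
  by have := uK k; rewrite ler_norml => /andP[_]; lra.
have ab j k : a j <= b k.
  apply: (@le_trans _ _ (a (maxn j k))); first by apply: ua; rewrite leq_maxl.
  apply: (@le_trans _ _ (b (maxn j k))); last by apply: ub; rewrite leq_maxr.
  have : 0 <= 2 * K / 2 ^+ maxn j k by rewrite !mulr_ge0// invr_ge0 exprn_ge0.
  by rewrite /a /b; lra.
exists (sup (range a)) => k; rewrite distrC ler_norml; apply/andP; split.
  rewrite lerBrDl; apply: ub_le_sup; last by exists k.
  by exists (b 0%N) => _ [j _ <-].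
rewrite lerBlDl; apply: ge_sup; first by exists (a 0%N), 0%N.
by move=> _ [j _ <-]; exact: ab.
Qed.

Context {n : nat}.

Lemma geometric_limit_mx (u : nat -> 'cV[R]_n) (K : R) : 0 <= K ->
  (forall k, `|u k.+1 - u k| <= K / 2 ^+ k) ->
  exists l, forall k, `|u k - l| <= 2 * K / 2 ^+ k.
Proof.
move=> K0 uK.
have /choice[l ul] : forall i : 'I_n,
    exists l, forall k, `|u k i 0 - l| <= 2 * K / 2 ^+ k.
  move=> i; apply: geometric_limit => // k; apply: le_trans (uK k).
  by have := mx_entry_le_norm (u k.+1 - u k) i 0; rewrite !mxE.
exists (\col_i l i) => k; apply/mx_norm_leP.
  by rewrite !mulr_ge0// invr_ge0 exprn_ge0.
by move=> i j; rewrite ord1 !mxE.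
Qed.

Variables (g : 'cV[R]_n -> 'cV[R]_n) (x0 : 'cV[R]_n) (B L : R).
Hypotheses (gB : forall x, `|g x| <= B) (L1 : 1 <= L)
  (gL : forall x y, `|g x - g y| <= L * `|x - y|).

(* The time argument is reflected to [`|s|] so that the integrand is continuous
   on the whole line. *)
Definition picard_operator (phi : R -> 'cV[R]_n) (t : R) : 'cV[R]_n :=
  x0 + \col_i antiderivative (fun s => g (phi `|s|) i 0) t.

Local Notation T := picard_operator.

(** The invariant of the iteration: it makes the integrand continuous, is preserved by the operator
    because [g] is bounded by [B], and passes to the limit. *)
Let lip (phi : R -> 'cV[R]_n) :=
  forall s t, 0 <= s -> 0 <= t -> `|phi s - phi t| <= B * `|s - t|.

Let B0 : 0 <= B.
Proof. exact: le_trans (gB 0). Qed.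

Lemma picard_operator0 phi : T phi 0 = x0.
Proof.
by apply/matrixP => i j; rewrite !mxE /antiderivative subrr addr0 ord1.
Qed.

Lemma is_derive_picard_operator phi (t : R) : lip phi -> 0 <= t ->
  is_derive t 1 (T phi) (g (phi t)).
Proof.
move=> philip t0; rewrite -[g _]add0r; apply: is_deriveD.
apply/is_derive_mxP => i j; rewrite ord1.
have -> : (fun x : R => (\col_i antiderivative (fun s => g (phi `|s|) i 0) x) i 0) =
    antiderivative (fun s => g (phi `|s|) i 0) by apply/funext => x; rewrite mxE.
have -> : g (phi t) i 0 = (fun s => g (phi `|s|) i 0) t by rewrite ger0_norm.
apply: is_derive_antiderivative => //.
(* Reflection of time is 1-Lipschitz, so the integrand has constant [L * B] on the whole line. *)
apply: (@lipschitz_real_continuous _ (L * B)) => r s.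
have := mx_entry_le_norm (g (phi `|r|) - g (phi `|s|)) i 0.
rewrite !mxE => /le_trans; apply; apply: le_trans (gL _ _) _.
rewrite -mulrA ler_wpM2l ?(le_trans ler01)//.
rewrite (le_trans (philip _ _ _ _))// ler_wpM2l//.
exact: ler_dist_dist.
Qed.

Lemma picard_operator_lip phi : lip phi -> lip (T phi).
Proof.
move=> philip; have key (s t : R) : 0 <= s -> s <= t ->
    `|T phi t - T phi s| <= B * `|t - s|.
  move=> s0 st; rewrite [`|t - s|]ger0_norm ?subr_ge0// mulrBr.
  apply: (@derive_le_increment_mx _ _ (T phi) (g \o phi)
    (fun t => B * t) (cst B)) => //.
  - by move=> r r0; exact: is_derive_picard_operator.
  - move=> r _; have := @is_deriveZ _ _ _ id B r 1 1 _.
    by rewrite /GRing.scale/= mulr1; apply.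
  - by move=> r _ /=.
move=> s t s0 t0; have [st|/ltW ts] := leP s t; last exact: key.
by rewrite distrC [`|s - t|]distrC key.
Qed.

(* The weight [expR (2 * L * t)] makes the Picard operator a contraction of
   ratio 1/2 on the whole half-line. *)
Lemma picard_operator_contraction phi psi (K : R) : lip phi -> lip psi ->
  (forall t, 0 <= t -> `|phi t - psi t| <= K * expR (2 * L * t)) ->
  forall t, 0 <= t -> `|T phi t - T psi t| <= K / 2 * expR (2 * L * t).
Proof.
move=> hphi hpsi pK t t0.
have K0 : 0 <= K.
  by rewrite -(pmulr_lge0 _ (expR_gt0 (2 * L * t))) (le_trans _ (pK t t0)).
(* The comparison function has derivative [L * K * expR (2 * L * t)], exactly the Lipschitz bound on
   the integrands; its value at [0] is nonnegative and is dropped. *)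
have := @derive_le_increment_mx _ _ (T phi - T psi) (fun t => g (phi t) - g (psi t))
  (fun t => K / 2 * expR (2 * L * t)) (fun t => K / 2 * (expR (2 * L * t) * (2 * L)))
  _ _ _ 0 t (lexx 0) t0.
rewrite !fctE !picard_operator0 subrr subr0 => h.
apply: le_trans (h _ _ _) _.
- move=> r r0; have := is_derive_picard_operator hphi r0.
  have := is_derive_picard_operator hpsi r0 => ? ?; exact: is_deriveB.
- by move=> r _; exact: (is_deriveZ (K / 2) (is_derive_expRM (2 * L) r)).
- move=> r r0; apply: le_trans (gL _ _) _.
  apply: le_trans (ler_wpM2l _ (pK r r0)) _; first exact: le_trans L1.
  by rewrite le_eqVlt; apply/orP; left; apply/eqP; field.
by rewrite gerBl mulr_ge0 ?expR_ge0// divr_ge0.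
Qed.

(** The iterates from the constant [x0] converge geometrically at each time; the limit is a fixed
    point of the operator, whose derivative is known. *)
Lemma bounded_lipschitz_ode_global_solution :
  exists2 phi : R -> 'cV[R]_n, phi 0 = x0 &
    forall t : R, 0 <= t -> is_derive t 1 phi (g (phi t)).
Proof.
pose p k := iter k T (cst x0).
have plip k : lip (p k).
  elim: k => [|k IH]; last exact: picard_operator_lip.
  by move=> s t _ _; rewrite subrr normr0 mulr_ge0.
have pstep k t : 0 <= t -> `|p k.+1 t - p k t| <= B / 2 ^+ k * expR (2 * L * t).
  elim: k t => [|k IH] t t0.
    have := plip 1%N t 0 t0 (lexx 0).
    rewrite [p 1%N 0]picard_operator0 subr0 ger0_norm// => /le_trans; apply.
    (* The first step moves by at most [B * t], and [t <= 1 + 2 * L * t <= expR (2 * L * t)] since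
       [1 <= L]. *)
    rewrite expr0 divr1 ler_wpM2l// (le_trans _ (expR_ge1Dx _))//.
    by have := ler_wpM2r t0 L1; rewrite mul1r -mulrA; lra.
  rewrite exprSr invfM mulrA.
  exact: picard_operator_contraction (IH) _ t0.
have /choice[q pq] : forall t, exists l, 0 <= t ->
    forall k, `|p k t - l| <= 2 * (B * expR (2 * L * t)) / 2 ^+ k.
  move=> t; have [t0|t0] := leP 0 t; last by exists 0.
  have [||l hl] := @geometric_limit_mx (fun k => p k t) (B * expR (2 * L * t)).
  - by rewrite mulr_ge0 ?expR_ge0.
  - by move=> k; have := pstep k t t0; rewrite mulrAC.
  - by exists l.
have qlip : lip q.
  move=> s t s0 t0.
  apply: (@le_geometric_eps _ _ (2 * (B * expR (2 * L * s)) +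
    2 * (B * expR (2 * L * t)))) => k.
  have := pq s s0 k; have := pq t t0 k; have := plip k s t s0 t0.
  have -> : q s - q t = (p k s - p k t) + (p k t - q t) - (p k s - q s).
    by rewrite subrKA opprB [RHS]addrC subrKA.
  move=> h1 h2 h3; apply: le_trans (ler_normB _ _) _.
  by have := ler_normD (p k s - p k t) (p k t - q t); rewrite mulrDl; lra.
(* Both sides are compared with [p k.+1 t], the left one through the contraction applied to [q] and
   [p k]. *)
have Tq t : 0 <= t -> T q t = q t.
  move=> t0; apply/eqP; rewrite -subr_eq0 -normr_le0.
  apply: (@le_geometric_eps _ _ (2 * (B * expR (2 * L * t)))) => k.
  have h1 : `|T q t - p k.+1 t| <= 2 * B / 2 ^+ k / 2 * expR (2 * L * t).
    apply: picard_operator_contraction => // r r0.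
    by rewrite distrC (le_trans (pq r r0 k))// mulrA mulrAC.
  have h2 := pq t t0 k.+1.
  rewrite add0r -(subrKA (p k.+1 t)); apply: le_trans (ler_normD _ _) _.
  apply: le_trans (lerD h1 h2) _.
  rewrite le_eqVlt; apply/orP; left; apply/eqP; rewrite exprS; field.
  by rewrite expf_neq0.
(* At negative times [q] is unspecified, whereas [T q] has a two-sided derivative at [0]. *)
exists (T q); first exact: picard_operator0.
by move=> t t0; rewrite Tq//; exact: is_derive_picard_operator.
Qed.

End picard.

(** * Projection onto a box *)

Section clipping.
Context {R : realType} {n : nat}.

Definition clip (M : R) (x : 'cV[R]_n) : 'cV[R]_n :=
  \col_i Num.max (- M) (Num.min M (x i 0)).

Lemma clip_norm (M : R) x : 0 <= M -> `|clip M x| <= M.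
Proof.
move=> M0; apply/mx_norm_leP => // i j; rewrite mxE ler_norml.
by rewrite le_max lexx/= ge_max ge_min lexx andbT (le_trans _ M0)// oppr_le0.
Qed.

Lemma clip_id (M : R) x : `|x| <= M -> clip M x = x.
Proof.
move=> xM; apply/colP => i; rewrite mxE.
have := le_trans (mx_entry_le_norm x i 0) xM; rewrite ler_norml => /andP[x1 x2].
by rewrite min_r// max_r.
Qed.

Lemma clip_lip (M : R) x y : 0 <= M -> `|clip M x - clip M y| <= `|x - y|.
Proof.
move=> M0; apply/mx_norm_leP => // i j; rewrite ord1 !mxE.
have := mx_entry_le_norm (x - y) i 0; rewrite !mxE; apply: le_trans.
move: (x i 0) (y i 0) => a b.
rewrite ler_norml; have := ler_norm (a - b); have := ler_norm (b - a).
rewrite [`|b - a|]distrC /Num.max /Num.min => h1 h2.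
by case: (ltP M a) => ?; case: (ltP M b) => ?;
  do ?[case: ifPn; rewrite -?leNgt => ?]; apply/andP; split; lra.
Qed.

End clipping.

(** * Lipschitz bounds and the clipped equation for the quadratic field *)

Section quadratic_field.
Context {R : realType} {n : nat}.

Lemma mulmx_norm_le (A : 'M[R]_n) :
  exists2 a : R, 0 <= a & forall x : 'cV[R]_n, `|A *m x| <= a * `|x|.
Proof.
have a0 : 0 <= \sum_i \sum_j `|A i j|.
  by apply: sumr_ge0 => i _; exact: sumr_ge0.
exists (\sum_i \sum_j `|A i j|) => // x.
apply/mx_norm_leP => [|i k]; first by rewrite mulr_ge0.
rewrite mxE (le_trans (ler_norm_sum _ _ _))//.
apply: (@le_trans _ _ ((\sum_j `|A i j|) * `|x|)).
  rewrite mulr_suml; apply: ler_sum => j _.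
  by rewrite normrM ler_wpM2l// mx_entry_le_norm.
rewrite ler_wpM2r// [leRHS](bigD1 i)//= lerDl.
by apply: sumr_ge0 => l _; exact: sumr_ge0.
Qed.

Lemma quad_field_locally_lipschitz (A : 'M[R]_n) (H : 'I_n -> 'M[R]_n) (M : R) :
  0 <= M -> exists2 L : R, 0 <= L &
    forall x y : 'cV[R]_n, `|x| <= M -> `|y| <= M ->
      `|quad_field A H x - quad_field A H y| <= L * `|x - y|.
Proof.
move=> M0; have [a a0 Aa] := mulmx_norm_le A.
have /choice[h hP] : forall i, exists h : R, 0 <= h /\
    forall x : 'cV[R]_n, `|H i *m x| <= h * `|x|.
  by move=> i; have [h h0 Hh] := mulmx_norm_le (H i); exists h.
exists (a + \sum_i 2 * M * h i).
  rewrite addr_ge0// sumr_ge0// => i _; have [h0 _] := hP i.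
  by rewrite !mulr_ge0.
move=> x y xM yM; rewrite !quad_fieldE opprD addrACA -mulmxBr -sumrB mulrDl.
apply: le_trans (ler_normD _ _) _; apply: lerD => //.
apply: le_trans (ler_norm_sum _ _ _) _; rewrite mulr_suml; apply: ler_sum => i _.
have [h0 Hh] := hP i.
(* The mixed term [x i 0 *: (H i *m y)] is subtracted and added, so that each summand is linear in
   [x - y]. *)
have -> : x i 0 *: (H i *m x) - y i 0 *: (H i *m y) =
    x i 0 *: (H i *m (x - y)) + (x - y) i 0 *: (H i *m y).
  by rewrite mulmxBr scalerBr !mxE scalerBl subrKA.
have xi := le_trans (mx_entry_le_norm x i 0) xM.
have xyi := mx_entry_le_norm (x - y) i 0.
apply: le_trans (ler_normD _ _) _; rewrite !normrZ.
have -> : 2 * M * h i * `|x - y| = M * (h i * `|x - y|) + `|x - y| * (h i * M) by ring.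
apply: lerD; apply: ler_pM => //.
by apply: le_trans (Hh y) _; rewrite ler_wpM2l.
Qed.

Lemma quad_field_clipped_solution (A : 'M[R]_n) (H : 'I_n -> 'M[R]_n) (M : R)
    (x0 : 'cV[R]_n) : 0 <= M ->
  exists2 phi : R -> 'cV[R]_n, phi 0 = x0 &
    forall t : R, 0 <= t -> is_derive t 1 phi (quad_field A H (clip M (phi t))).
Proof.
move=> M0; have [L L0 fL] := quad_field_locally_lipschitz A H M0.
pose g x := quad_field A H (clip M x).
(* The field differs from its value at [0] by at most [L * M] on the box; [1 + L] secures a constant
   at least 1. *)
apply: (@bounded_lipschitz_ode_global_solution _ _ g x0
  (`|quad_field A H 0| + L * M) (1 + L)) => [x||x y].
- rewrite addrC -lerBlDr (le_trans (lerB_dist _ _))//.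
  rewrite (le_trans (fL _ _ _ _)) ?clip_norm ?normr0//.
  by rewrite subr0 ler_wpM2l// clip_norm.
- by rewrite lerDl.
- rewrite (le_trans (fL _ _ _ _)) ?clip_norm//.
  by rewrite ler_pM ?lerDr// clip_lip.
Qed.

End quadratic_field.

(** * Invariance of the ellipsoid and convergence of trajectories *)

Section lyapunov.
Context {R : realType} {n : nat}.
Variables (f : 'cV[R]_n -> 'cV[R]_n) (Q : 'M[R]_n) (c d : R).
Hypotheses (Qpos : posdef Q) (c0 : 0 < c) (d0 : 0 < d).
Hypothesis decay : forall x : 'cV[R]_n, qform Q x <= 1 + d ->
  2 * (x^T *m Q *m f x) 0 0 <= - c * qform Q x.

(** The norm on vectors is the largest entry in absolute value, so it lies below the Euclidean norm,
    and coercivity applies. *)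
Lemma norm_le_qform :
  exists2 k : R, 0 < k & forall x : 'cV[R]_n, `|x| ^+ 2 <= k * qform Q x.
Proof.
have [k k0 kQ] := posdef_coercive Qpos.
exists k^-1; first by rewrite invr_gt0.
move=> x; rewrite ler_pdivlMl//; apply: le_trans (kQ x); rewrite ler_wpM2l ?(ltW k0)//.
have s0 := qform1_ge0 x.
rewrite -[leRHS]sqr_sqrtr// lerXn2r ?nnegrE ?sqrtr_ge0//.
apply/mx_norm_leP => [|i j]; first exact: sqrtr_ge0.
rewrite ord1 -sqrtr_sqr ler_wsqrtr// qform1E (bigD1 i)//= lerDl.
by rewrite sumr_ge0// => l _; exact: sqr_ge0.
Qed.

Section trajectory.
Variables (g : 'cV[R]_n -> 'cV[R]_n) (phi : R -> 'cV[R]_n).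
(** Taking [g] to be [f] treats true solutions; taking it clipped treats the solution constructed by
    Picard iteration. *)
Hypothesis gf : forall x, qform Q x <= 1 + d -> g x = f x.
Hypothesis cphi : {within `[0, +oo[, continuous phi}.
Hypothesis dphi : forall t : R, 0 < t -> is_derive t 1 phi (g (phi t)).
Hypothesis phi0 : qform Q (phi 0) <= 1.

Let dW (t : R) : 0 < t ->
  is_derive t 1 (qform Q \o phi) (2 * ((phi t)^T *m Q *m g (phi t)) 0 0).
Proof. by move=> /dphi; exact: is_derive_qform Qpos.1. Qed.

Let cW : {within `[0, +oo[, continuous (qform Q \o phi)}.
Proof.
apply: within_continuous_comp cphi => x _.
exact/differentiable_continuous/differentiable_qform.
Qed.

Lemma sublevel_invariant t : 0 <= t -> qform Q (phi t) <= 1.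
Proof.
apply: (decay_invariant d0 (ltW c0) cW dW ler01 phi0) => s s0 Ws.
by rewrite gf// decay.
Qed.

Lemma trajectory_cvg0 : phi t @[t --> +oo] --> (0 : 'cV[R]_n).
Proof.
have [k k0 Qk] := norm_le_qform.
apply/cvgrPdist_lt => /= e e0.
(* Beyond this time [expR (c * t) >= 1 + c * t > k / e ^+ 2], hence
   [|phi t|^2 <= k * expR (- c * t) < e ^+ 2]. *)
have T0 : 0 <= k / e ^+ 2 / c by rewrite !divr_ge0 ?exprn_ge0// ltW.
have Tt : \forall t \near +oo, k / e ^+ 2 / c < t.
  by apply: nbhs_pinfty_gt; exact: num_real.
apply: filterS Tt => t Tt.
have t0 : 0 < t by exact: le_lt_trans Tt.
have ct : k / e ^+ 2 < c * t by rewrite [c * t]mulrC -ltr_pdivrMr.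
have W1 : qform Q (phi t) <= expR (- c * t).
  have := decay_exp cW dW (c := c) _ (ltW t0).
  move=> /(_ _)/le_trans; apply.
    move=> s s0; rewrite gf ?decay//.
      by rewrite (le_trans (sublevel_invariant (ltW s0)))// lerDl ltW.
    by rewrite (le_trans (sublevel_invariant (ltW s0)))// lerDl ltW.
  by rewrite -[leRHS]mul1r ler_wpM2r ?expR_ge0.
rewrite sub0r normrN -(ltr_pXn2r (n := 2)) ?nnegrE ?(ltW e0)//.
apply: le_lt_trans (Qk _) _; rewrite mulrC -ltr_pdivlMr//.
apply: le_lt_trans W1 _; rewrite mulNr expRN -[ltRHS]invrK.
rewrite ltf_pV2 ?posrE ?expR_gt0 ?invr_gt0 ?divr_gt0 ?exprn_gt0//.
rewrite invf_div (lt_le_trans ct)// (le_trans _ (expR_ge1Dx _))// lerDr//.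
Qed.

End trajectory.

End lyapunov.

(** * Attraction and the Lyapunov property on the ellipsoid *)

Theorem corollary1 (R : realType) (n : nat) (n_gt0 : (0 < n)%N)
    (A : 'M[R]_n) (H : 'I_n -> 'M[R]_n)
    (H_sym : forall x1 x2 : 'cV[R]_n,
       (\mxrow_(i < n) H i) *m kron x1 x2 = (\mxrow_(i < n) H i) *m kron x2 x1)
    (eps : R) (eps_gt0 : 0 < eps)
    (P : 'M[R]_n) (P_sym : P = P^T) (P_pos : posdef P)
    (P_lmi : negdef
       (block_mx
          (A *m P + P *m A^T + eps *: \sum_(i < n) (H i *m P *m (H i)^T)) P
          P (- (eps *: 1%:M)))) :
  let E : set 'cV[R]_n := [set x | (x^T *m invmx P *m x) 0 0 <= 1] in
  let V : 'cV[R]_n -> R := fun x => (x^T *m invmx P *m x) 0 0 in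
  E `<=` region_of_attraction (quad_field A H) /\
  is_lyapunov (quad_field A H) E V.
Proof.
move=> E V; rewrite -[V]/(qform (invmx P)).
have Q_pos := posdef_invmx P_pos.
have [d d_gt0 [c c_gt0 decay]] := lyapunov_decay eps_gt0 P_pos P_lmi.
have le1d x : E x -> qform (invmx P) x <= 1 + d.
  by move=> /le_trans; apply; rewrite lerDl ltW.
split=> [x0 Ex0|].
  split=> [|phi [phi0 cphi dphi]]; last first.
    apply: (trajectory_cvg0 Q_pos c_gt0 d_gt0 decay _ cphi dphi) => //.
    by rewrite phi0; exact: Ex0.
  have [k k_gt0 normQ] := norm_le_qform Q_pos.
  (* From [|x|^2 <= k * (1 + d)] follows [|x| <= 1 + k * (1 + d)], without a square root. *)
  pose M := 1 + k * (1 + d).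
  have M_ge0 : 0 <= M by rewrite addr_ge0// mulr_ge0 ?addr_ge0// ltW.
  have normM x : qform (invmx P) x <= 1 + d -> `|x| <= M.
    move=> xd; have := le_trans (normQ x) (ler_wpM2l (ltW k_gt0) xd).
    rewrite /M; have := normr_ge0 x; nra.
  have [phi phi0 dphi] := quad_field_clipped_solution A H x0 M_ge0.
  have cphi : {within `[0, +oo[, continuous phi}.
    apply: derivable_within_continuous => t /[!in_itv]/= /[!andbT]/dphi.
    by move=> ?; exact: ex_derive.
  exists phi; split=> // t t_gt0.
  (* Clipping is the identity at [phi t] once [V (phi t) <= 1], which invariance under the clipped
     field supplies. *)
  have := dphi t (ltW t_gt0); rewrite clip_id// normM// le1d//.
  have gf x : qform (invmx P) x <= 1 + d ->
      quad_field A H (clip M x) = quad_field A H x by move=> /normM/clip_id ->.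
  have V0 : qform (invmx P) (phi 0) <= 1 by rewrite phi0; exact: Ex0.
  have dphi' (s : R) : 0 < s -> is_derive s 1 phi (quad_field A H (clip M (phi s))).
    by move=> /ltW/dphi.
  exact: (sublevel_invariant Q_pos c_gt0 d_gt0 decay gf cphi dphi' V0 (ltW t_gt0)).
split=> [x _||x _ x_neq0||x Ex x_neq0].
- exact: differentiable_qform.
- exact: qform0.
- exact: Q_pos.2.
- by rewrite orbital_derivative_qform ?Q_pos.1// trmx0 !mul0mx mxE mulr0.
- rewrite orbital_derivative_qform ?Q_pos.1// (le_lt_trans (decay x (le1d x Ex)))//.
  by rewrite mulNr oppr_lt0 mulr_gt0// Q_pos.2.
Qed.
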